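(* Let $m\ge 1$ be an integer and let $\mathbf{u}(-m)$ be the linear functional on the space $\mathbb{P}$ of complex polynomials given by $$\langle \mathbf{u}(-m),f\rangle=\int_{0}^\infty \Big[(f(x)+f(-x))e^{-x^2}-\sum_{k=0}^{2m-2}\Big(e^{-x^2}[f(x)+f(-x)]\Big)^{(k)}(0)\,\frac{x^k}{k!}\Big]x^{-2m}\,dx .$$ Then $\mathbf{u}(-m)$ is semiclassical of class $1$. Moreover, it satisfies the Pearson equation $$D(\phi\,\mathbf{u}(-m))+\psi\,\mathbf{u}(-m)=\mathbf{0},\qquad \phi(x)=x,\quad \psi(x)=2x^2+2m-1 .$$
   Context: For a linear functional $\mathbf{u}:\mathbb{P}\to\mathbb{C}$ and a polynomial $q$, $\langle q\mathbf{u},p\rangle=\langle\mathbf{u},qp\rangle$ and $\langle D\mathbf{u},p\rangle=-\langle\mathbf{u},p'\rangle$ for all $p\in\mathbb{P}$. The functional $\mathbf{u}$ is quasi-definite if there is a sequence of monic polynomials $(P_n)_{n\ge0}$ with $\deg P_n=n$ and $\langle\mathbf{u},P_nP_k\rangle=K_n\delta_{n,k}$, $K_n\neq0$. A quasi-definite functional $\mathbf{u}$ is semiclassical if there exist non-zero polynomials $\phi,\psi$ with $\deg\phi\ge0$ and $\deg\psi\ge1$ such that $D(\phi\mathbf{u})+\psi\mathbf{u}=\mathbf{0}$. The class of a semiclassical functional is $\min\max\{\deg\phi-2,\deg\psi-1\}$, the minimum taken over all such pairs $(\phi,\psi)$ satisfying this equation. *)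

(* Defs.v *)
From HB Require Import structures.
From mathcomp Require Import all_boot all_order all_algebra.
From mathcomp Require Import all_classical all_reals all_analysis.
From mathcomp Require Export complex.

Set Implicit Arguments.
Unset Strict Implicit.
Unset Printing Implicit Defensive.

Import Order.TTheory GRing.Theory Num.Theory.
Import numFieldNormedType.Exports.

Local Open Scope classical_set_scope.
Local Open Scope ring_scope.
Local Open Scope complex_scope.

(* Functionals are plain maps {poly R[i]} -> R[i]; where linearity matters it
   is the predicate [scalar u]. *)

Section Functionals.
Variable R : realType.
Local Notation C := R[i].
Implicit Types (u : {poly C} -> C) (p q phi psi : {poly C}).

Definition fmul q u : {poly C} -> C := fun p => u (q * p).

Definition fderiv u : {poly C} -> C := fun p => - u p^`().

Definition pearson phi psi u : Prop :=
  forall p, fderiv (fmul phi u) p + fmul psi u p = 0.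

Definition quasi_definite u : Prop :=
  exists (P : nat -> {poly C}) (K : nat -> C),
    [/\ forall n, P n \is monic /\ size (P n) = n.+1,
        forall n, K n != 0 &
        forall n k, u (P n * P k) = K n * (n == k)%:R].

Definition deg p : nat := (size p).-1.

Definition admissible_pair u phi psi : Prop :=
  [/\ phi != 0, psi != 0, (1 <= deg psi)%N & pearson phi psi u].

Definition semiclassical u : Prop :=
  quasi_definite u /\ exists phi psi, admissible_pair u phi psi.

(* integer subtraction: deg phi - 2 may be negative *)
Definition pair_order phi psi : int :=
  Num.max ((deg phi)%:Z - 2) ((deg psi)%:Z - 1).

Definition has_class u (s : int) : Prop :=
  (exists phi psi, admissible_pair u phi psi /\ pair_order phi psi = s) /\
  (forall phi psi, admissible_pair u phi psi -> s <= pair_order phi psi).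

End Functionals.

Section ComplexValued.
Variable R : realType.
Implicit Types (g : R -> R[i]) (D : set R).

(* Calculus of complex-valued functions of a real variable, componentwise. *)

Definition cderiven (k : nat) g (x : R) : R[i] :=
  derive1n k (fun t => complex.Re (g t)) x +i*
  derive1n k (fun t => complex.Im (g t)) x.

Definition cintegrable D g : Prop :=
  (@lebesgue_measure R).-integrable D (fun x => (complex.Re (g x))%:E) /\
  (@lebesgue_measure R).-integrable D (fun x => (complex.Im (g x))%:E).

Definition cintegral D g : R[i] :=
  Rintegral (@lebesgue_measure R) D (fun x => complex.Re (g x)) +i*
  Rintegral (@lebesgue_measure R) D (fun x => complex.Im (g x)).

End ComplexValued.

Section GeneralizedHermite.
Variable R : realType.
Implicit Types (m : nat) (f : {poly R[i]}).

Definition sym_gauss f (x : R) : R[i] :=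
  (f.[x%:C] + f.[(- x)%:C]) * (expR (- x ^+ 2))%:C.

(* meant for m >= 1, since 2 * m - 2 is truncated *)
Definition hermite_integrand m f (x : R) : R[i] :=
  (sym_gauss f x
   - \sum_(0 <= k < (2 * m - 2).+1)
       cderiven k (sym_gauss f) 0 * (x ^+ k / k`!%:R)%:C)
  * (x ^- (2 * m))%:C.

Definition hermite_functional m f : R[i] :=
  cintegral `]0, +oo[ (hermite_integrand m f).

End GeneralizedHermite.

(* Main.v *)
Require Import Defs.
From HB Require Import structures.
From mathcomp Require Import all_boot all_order all_algebra.
From mathcomp Require Import all_classical all_reals all_analysis.
From mathcomp Require Import complex.
From mathcomp Require Import measurable_realfun ring zify.

(* For f = x^(2n) the regularised integrand is twice
   w_n(x) = x^(2n) x^(-2m) E(x^2), where E(t) is the Taylor remainder of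
   exp(-t) of order max(m - n, 0); odd powers give 0.  Alternation of the
   remainders gives w_n(x) = O(1/(1 + x^2)) on ]0, oo[, and integrating
     (x w_n)' = (2n + 1 - 2m) w_n - 2 w_(n+1)
   yields the moment recurrence 2 u_(k+2) = (k + 1 - 2m) u_k.  Since u_(2m) is
   a Gaussian integral, u_0 <> 0, and the rest is algebra:
   - on monomials, the Pearson equation is the moment recurrence;
   - if T is half the Dunkl operator, the adjoint of T for u is q |-> x q - T q,
     so P_n = (x - T)^n 1 satisfies u(p P_n) = u(T^n p), which vanishes for
     deg p < n and not for deg p = n;
   - a pair (a x^2 + b x + c, d x + e) tested on x^(2k+1) gives
     t (a (t - 2m) + 2 c) = d (t - 2m) at every odd t, hence d m = 0, so no pair
     has order 0. *)

Set Implicit Arguments.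
Unset Strict Implicit.
Unset Printing Implicit Defensive.

Import Order.TTheory GRing.Theory Num.Theory.
Import numFieldNormedType.Exports.
Local Open Scope classical_set_scope.
Local Open Scope ring_scope.
Local Open Scope complex_scope.

(** * Functionals with the moments of the generalized Hermite weight *)

Lemma scalar_eq0 (F : nzRingType) (f : {poly F} -> F) :
  scalar f -> (forall n, f 'X^n = 0) -> forall p, f p = 0.
Proof.
move=> lf f0 p.
pose u : {scalar {poly F}} := HB.pack f (GRing.isLinear.Build _ _ _ _ f lf).
rewrite -[f]/(u : _ -> _) -[p]coefK poly_def linear_sum big1 // => i _.
by rewrite linearZ /= f0 mulr0.
Qed.

Section HermiteMoments.
Context {F : numFieldType}.
Variables (u : {scalar {poly F}}) (m : nat).

Definition hermite_moments : Prop :=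
  [/\ u 1 != 0, forall n, odd n -> u 'X^n = 0 &
      forall n, 2 * u 'X^(n.+2) = (n.+1%:R - (2 * m)%:R) * u 'X^n].

Hypothesis um : hermite_moments.

Lemma moment_odd n : odd n -> u 'X^n = 0. Proof. by case: um => _ + _; exact. Qed.

Lemma moment_rec n : 2 * u 'X^(n.+2) = (n.+1%:R - (2 * m)%:R) * u 'X^n.
Proof. by case: um. Qed.

Lemma odd_double_neq n : odd n -> n%:R - (2 * m)%:R != 0 :> F.
Proof.
move=> on; rewrite subr_eq0 eqr_nat; apply/eqP => e.
by move: on; rewrite e mul2n odd_double.
Qed.

(** At even [n] the factor n + 1 - 2m is odd, hence nonzero, so nonvanishing propagates upwards from
    [u 1]. *)
Lemma moment_even_neq0 n : u 'X^(n.*2) != 0.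
Proof.
elim: n => [|n IH]; first by rewrite double0 expr0; case: um.
have := moment_rec n.*2; rewrite doubleS => e.
have : 2 * u 'X^(n.*2.+2) != 0.
  by rewrite e mulf_neq0 // odd_double_neq //= odd_double.
by apply: contraNneq => ->; rewrite mulr0.
Qed.

(* [dunkl] is half the Dunkl operator
   [p |-> p' - m (p(x) - p(-x)) / x] of parameter [-m]. *)
Definition dunkl_coef i : F := (i%:R - (odd i * (2 * m))%:R) / 2.

Definition dunkl (p : {poly F}) : {poly F} :=
  \poly_(i < (size p).-1) (dunkl_coef i.+1 * p`_i.+1).

Lemma coef_dunkl p i : (dunkl p)`_i = dunkl_coef i.+1 * p`_i.+1.
Proof.
rewrite coef_poly; case: ltnP => // le_p.
by rewrite nth_default ?mulr0 // (leq_trans (leqSpred _)).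
Qed.

Fact dunkl_is_linear : linear dunkl.
Proof.
by move=> a p q; apply/polyP => i; rewrite !(coef_dunkl, coefD, coefZ); ring.
Qed.
HB.instance Definition _ :=
  GRing.isLinear.Build F {poly F} {poly F} _ dunkl dunkl_is_linear.

Lemma dunklXn n : dunkl 'X^n = dunkl_coef n *: 'X^(n.-1).
Proof.
apply/polyP => i; rewrite coef_dunkl coefZ !coefXn.
case: n => [|n] /=; last by rewrite eqSS; case: eqP => [->|]; rewrite // !mulr0.
by rewrite /dunkl_coef mul0n subr0 !mul0r mulr0.
Qed.

Lemma dunkl_coef_neq0 n : dunkl_coef n.+1 != 0.
Proof.
rewrite /dunkl_coef mulf_neq0 ?invr_eq0 ?pnatr_eq0 //.
case: (boolP (odd n.+1)) => on; first by rewrite mul1n odd_double_neq.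
by rewrite mul0n subr0 pnatr_eq0.
Qed.

Lemma size_dunkl p : (size (dunkl p) <= (size p).-1)%N.
Proof. exact: size_poly. Qed.

Definition dunkl_raise (p : {poly F}) := 'X * p - dunkl p.

(** The adjoint relation on monomials. If i + j is odd, exactly one index is odd, the coefficients
    add up to (i + j - 2m) / 2, and this is the moment recurrence. If i + j is even, odd moments
    make both sides 0; at i = j = 0, where the predecessor truncates, the coefficients vanish. *)
Lemma moment_dunkl i j :
  (dunkl_coef i + dunkl_coef j) * u 'X^((i + j).-1) = u 'X^((i + j).+1).
Proof.
case: (boolP (odd (i + j))) => oij; last first.
  rewrite (@moment_odd (i + j).+1) //.
  case e : (i + j)%N => [|k] /=.
    have [-> ->] : i = 0%N /\ j = 0%N by lia.
    by rewrite /dunkl_coef mul0n subr0 !mul0r addr0 mul0r.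
  by rewrite moment_odd ?mulr0 //; move: oij; rewrite e /= negbK.
case e : (i + j)%N oij => [//|k] /= ok.
apply: (@mulfI _ 2); first by rewrite pnatr_eq0.
rewrite moment_rec -e natrD.
have : odd (i + j) by rewrite e.
rewrite oddD /dunkl_coef; case: (odd i); case: (odd j) => //= _;
  by rewrite mul0n mul1n; field.
Qed.

Lemma dunkl_adjoint p q : u (dunkl p * q) = u (p * dunkl_raise q).
Proof.
pose g p q := dunkl p * q - p * dunkl_raise q.
suff : u (g p q) = 0 by move/eqP; rewrite raddfB subr_eq0 => /eqP.
have gl q' : scalar (fun p => u (g p q')).
  move=> a x y; rewrite -[_ * _ + _]/(a *: u _ + _) -linearP; congr (u _).
  by rewrite /g linearP /= -!mul_polyC; ring.
have gr p' : scalar (fun q => u (g p' q)).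
  move=> a x y; rewrite -[_ * _ + _]/(a *: u _ + _) -linearP; congr (u _).
  by rewrite /g /dunkl_raise linearP /= -!mul_polyC; ring.
apply: (@scalar_eq0 _ (fun p => u (g p q))) => // i.
apply: (@scalar_eq0 _ (fun q => u (g 'X^i q))) => // j.
(* The exponents i.-1 + j and (i + j).-1 may differ at i = 0, but the coefficient is 0 there. *)
have hi : dunkl 'X^i * 'X^j = dunkl_coef i *: 'X^((i + j).-1).
  rewrite dunklXn -scalerAl -exprD; case: i => [|i] //=.
  by rewrite /dunkl_coef mul0n subr0 !mul0r !scale0r.
have hj : 'X^i * dunkl 'X^j = dunkl_coef j *: 'X^((i + j).-1).
  rewrite dunklXn -scalerAr -exprD; case: j {hi} => [|j] /=; last by rewrite addnS.
  by rewrite /dunkl_coef mul0n subr0 !mul0r !scale0r.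
rewrite /g /dunkl_raise mulrBr hi hj opprB addrA -scalerDl.
rewrite mulrCA -exprD -exprS raddfB /= linearZ /=.
by rewrite -moment_dunkl subrr.
Qed.

Definition dunkl_hermite n : {poly F} := iter n dunkl_raise 1.

Lemma dunkl_hermite_monic n :
  dunkl_hermite n \is monic /\ size (dunkl_hermite n) = n.+1.
Proof.
elim: n => [|n [mon sz]]; first by rewrite monic1 size_poly1.
have nz : dunkl_hermite n != 0 by rewrite -size_poly_eq0 sz.
have sX : size ('X * dunkl_hermite n) = n.+2 by rewrite mulrC size_mulX // sz.
have lt_s : (size (- dunkl (dunkl_hermite n)) < size ('X * dunkl_hermite n)%R)%N.
  by rewrite size_polyN sX ltnS (leq_trans (size_dunkl _)) // sz /=.
rewrite /dunkl_hermite iterS -/(dunkl_hermite n) /dunkl_raise.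
split; last by rewrite size_polyDl.
by rewrite monicE lead_coefDl // lead_coefM lead_coefX mul1r -monicE.
Qed.

Lemma moment_dunkl_hermite n p : u (p * dunkl_hermite n) = u (iter n dunkl p).
Proof.
elim: n p => [|n IH] p; first by rewrite mulr1.
by rewrite iterSr -IH dunkl_adjoint.
Qed.

Lemma size_iter_dunkl n (p : {poly F}) : (size (iter n dunkl p) <= size p - n)%N.
Proof.
elim: n => [|n IH]; first by rewrite subn0.
by rewrite iterS (leq_trans (size_dunkl _)) //; move: IH; lia.
Qed.

Lemma dunkl_hermite_ortho n (p : {poly F}) :
  (size p <= n)%N -> u (p * dunkl_hermite n) = 0.
Proof.
move=> sp; rewrite moment_dunkl_hermite.
suff /eqP -> : iter n dunkl p == 0 by rewrite raddf0.
by rewrite -size_poly_leq0 (leq_trans (size_iter_dunkl _ _)) // leqn0 subn_eq0.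
Qed.

(** Each application of [dunkl] lowers the degree by exactly one, because its coefficients do not
    vanish; after n steps a nonzero constant is left, and [u 1] is nonzero. *)
Lemma dunkl_hermite_norm_neq0 n (p : {poly F}) :
  p \is monic -> size p = n.+1 -> u (p * dunkl_hermite n) != 0.
Proof.
move=> mp sp; rewrite moment_dunkl_hermite.
have c0 : (iter n dunkl p)`_0 != 0.
  have : p`_(n + 0) != 0.
    by rewrite addn0 -[n]/(n.+1.-1) -sp -lead_coefE (monicP mp) oner_eq0.
  (* Generalised to an arbitrary index k: coefficient n + k of p ends up at position k. *)
  elim: n 0%N p {mp sp} => [//|n IH] k p pn.
  by rewrite iterSr IH // coef_dunkl mulf_neq0 // ?dunkl_coef_neq0.
have /size1_polyC e : (size (iter n dunkl p) <= 1)%N.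
  by rewrite (leq_trans (size_iter_dunkl _ _)) // sp subSnn.
rewrite e -[_%:P]mulr1 mul_polyC linearZ /= mulf_neq0 //.
by case: um.
Qed.

End HermiteMoments.

(** * Quasi-definiteness, Pearson equation and class from the moments *)

Section HermiteClass.
Context {R : realType}.
Variables (u : {scalar {poly R[i]}}) (m : nat).
Hypothesis um : hermite_moments u m.

Lemma hermite_quasi_definite : quasi_definite u.
Proof.
pose P := @dunkl_hermite R[i] m.
have monP n : P n \is monic := (@dunkl_hermite_monic R[i] m n).1.
have szP n : size (P n) = n.+1 := (@dunkl_hermite_monic R[i] m n).2.
exists P, (fun n => u (P n * P n)); split=> [n|n|n k].
- by split.
- exact: (@dunkl_hermite_norm_neq0 _ _ _ um n _ (monP n) (szP n)).
- case: (ltngtP n k) => [lt|lt|->]; last by rewrite mulr1.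
  + by rewrite mulr0 (dunkl_hermite_ortho um) // szP.
  + by rewrite mulr0 mulrC (dunkl_hermite_ortho um) // szP.
Qed.

Lemma hermite_pearson :
  (1 <= m)%N -> pearson 'X (2%:R *: 'X^2 + (2 * m - 1)%:R%:P) u.
Proof.
move=> m1.
pose g (p : {poly R[i]}) := (2%:R *: 'X^2 + (2 * m - 1)%:R%:P) * p - 'X * p^`().
move=> p; rewrite /fderiv /fmul addrC -raddfB -/(g p).
apply: (@scalar_eq0 _ (fun p => u (g p))) => [a x y|n].
  transitivity (u (a *: g x + g y)); last exact: linearP.
  by congr (u _); rewrite /g derivD derivZ -!mul_polyC; ring.
rewrite /g derivXn mulrDl -scalerAl -exprD add2n mul_polyC.
have -> : 'X * ('X^(n.-1) *+ n) = n%:R *: 'X^n :> {poly R[i]}.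
  by case: n => [|n]; rewrite ?scale0r ?mulr0 // mulrnAr -exprS scaler_nat.
rewrite raddfB raddfD /= !linearZ /= (moment_rec um).
(* Since m is at least 1, the truncated [2 * m - 1] is a true difference. *)
by rewrite natrB ?muln_gt0 ?m1 // -natr1 -[_ *: _]/(_ * _); ring.
Qed.

Lemma hermite_order_ge1 phi psi :
  (1 <= m)%N -> admissible_pair u phi psi -> 1 <= pair_order phi psi.
Proof.
move=> m1 [phi0 psi0 psi1 pu]; rewrite leNgt; apply/negP.
rewrite /pair_order gt_max => /andP[dphi dpsi].
have sphi : (size phi <= 3)%N by move: dphi; rewrite /deg; lia.
have spsi : (size psi = 2)%N by move: dpsi psi1; rewrite /deg; lia.
pose a := phi`_2; pose c := phi`_0; pose d := psi`_1.
have phiE : phi = a *: 'X^2 + phi`_1 *: 'X + c%:P.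
  apply/polyP => i; rewrite !coefD !coefZ coefXn coefX coefC.
  case: i => [|[|[|i]]] /=; rewrite ?mulr0 ?mulr1 ?addr0 ?add0r //.
  by rewrite nth_default // (leq_trans sphi).
have psiE : psi = d *: 'X + (psi`_0)%:P.
  apply/polyP => i; rewrite !coefD !coefZ coefX coefC.
  case: i => [|[|i]] /=; rewrite ?mulr0 ?mulr1 ?addr0 ?add0r //.
  by rewrite nth_default // spsi.
(* On an odd power x^t the coefficients [phi]_1[and]psi[_0] meet only odd moments. Multiplying the
   equation by -2 and eliminating the moment of order t + 1 leaves g(t) times the nonzero moment of
   order t - 1. *)
pose g (t : R[i]) := t * (a * (t - (2 * m)%:R) + 2 * c) - d * (t - (2 * m)%:R).
have g0 k : g (k.*2.+1)%:R = 0.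
  have := pu 'X^(k.*2.+1).
  rewrite /fderiv /fmul derivXn /= mulrnAr raddfMn /= phiE psiE.
  rewrite !mulrDl -!scalerAl !mul_polyC -!exprD -!exprS !raddfD /= !linearZ /=.
  rewrite add2n !(@moment_odd _ _ _ um k.*2.+1) /= ?odd_double //.
  rewrite !mulr0 !addr0 -[in _ *+ _]mulr_natl => e.
  have u2 := moment_rec um k.*2.
  apply: (mulIf (moment_even_neq0 um k)); rewrite mul0r.
  transitivity (-2 * (- (k.*2.+1%:R * (a * u 'X^(k.*2.+2) + c * u 'X^(k.*2)))
     + d * u 'X^(k.*2.+2))); last by rewrite e mulr0.
  transitivity (k.*2.+1%:R * (a * ((k.*2.+1%:R - (2 * m)%:R) * u 'X^(k.*2))
      + 2 * c * u 'X^(k.*2)) - d * ((k.*2.+1%:R - (2 * m)%:R) * u 'X^(k.*2))).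
    by rewrite /g; ring.
  by rewrite -u2; ring.
(* The quadratic [g] vanishes at 1, 3, 5; interpolating gives its value at 0. *)
have : 8 * d * (2 * m)%:R = 0.
  transitivity (15 * g 1 - 10 * g 3 + 3 * g 5); first by rewrite /g; ring.
  by rewrite (g0 0) (g0 1) (g0 2) !mulr0 subrr addr0.
have dn0 : d != 0 by rewrite /d -[1%N]/(2.-1) -spsi -lead_coefE lead_coef_eq0.
by apply/eqP; rewrite !mulf_neq0 // ?pnatr_eq0 // muln_eq0 -lt0n m1.
Qed.

Lemma hermite_has_class1 : (1 <= m)%N -> has_class u 1.
Proof.
move=> m1; split=> [|phi psi]; last exact: hermite_order_ge1.
have s3 : size (2%:R *: 'X^2 + (2 * m - 1)%:R%:P : {poly R[i]}) = 3.
  rewrite size_polyDl size_scale ?pnatr_eq0 // size_polyXn //.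
  by rewrite ltnS (leq_trans (size_polyC_leq1 _)).
exists 'X, (2%:R *: 'X^2 + (2 * m - 1)%:R%:P); split.
  by split; rewrite ?polyX_eq0 -?size_poly_eq0 ?/deg ?s3 //; exact: hermite_pearson.
by rewrite /pair_order /deg s3 size_polyX.
Qed.

End HermiteClass.

(** * Taylor remainders of the exponential *)

Section ExpTail.
Context {R : realType}.
Implicit Types (k n : nat) (t x : R).

Lemma is_derive_fun (f g : R -> R) x (df dg : R) :
  f =1 g -> df = dg -> is_derive x 1 f df -> is_derive x 1 g dg.
Proof. by move=> /funext -> ->. Qed.

Definition exp_poly k : {poly R} := \poly_(j < k) ((-1) ^+ j / j`!%:R).

(** Only the k terms of degree below k are removed, so [exp_tail 0] is exp(-t) itself. *)
Definition exp_tail k t := expR (- t) - (exp_poly k).[t].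

Lemma exp_tailS k t : exp_tail k.+1 t = exp_tail k t - (-1) ^+ k / k`!%:R * t ^+ k.
Proof.
by rewrite /exp_tail !horner_poly big_ord_recr /= opprD addrA.
Qed.

Lemma exp_tail0 k : exp_tail k.+1 0 = 0.
Proof.
rewrite /exp_tail oppr0 expR0 horner_coef0 coef_poly /=.
by rewrite expr0 fact0 divr1 subrr.
Qed.

Lemma deriv_exp_poly k : (exp_poly k)^`() = - exp_poly k.-1.
Proof.
apply/polyP => i.
rewrite coefN coef_deriv !coef_poly; case: k => [|k] /=; first by rewrite mul0rn oppr0.
rewrite ltnS; case: ifP; rewrite ?mul0rn ?oppr0 // => _.
rewrite exprS factS natrM -mulr_natr; field.
by rewrite nat1r !pnatr_eq0 -lt0n fact_gt0.
Qed.

(** The truncated predecessor is right at k = 0 too, as exp(-t) is minus its own derivative. *)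
Lemma is_derive_exp_tail k t : is_derive t 1 (exp_tail k) (- exp_tail k.-1 t).
Proof.
have d1 : is_derive t 1 (fun s => expR (- s)) (- expR (- t)).
  by apply: is_derive_eq; rewrite mulrN1.
apply: (@is_derive_fun _ _ _ _ _ _ _ (is_deriveB d1 (is_derive_poly (exp_poly k) t))).
  by [].
rewrite /exp_tail opprB [RHS]addrC; congr (_ + _).
by rewrite deriv_exp_poly hornerN opprK.
Qed.

Lemma ge0_of_deriv (f df : R -> R) t :
  (forall x, 0 <= x -> is_derive x 1 f (df x)) ->
  (forall x, 0 <= x -> 0 <= df x) -> 0 <= f 0 -> 0 <= t -> 0 <= f t.
Proof.
move=> fdf df0 f0 t0.
have [||c] := @MVT_segment R f df 0 t t0.
- by move=> x; rewrite in_itv /= => /andP[/ltW + _]; exact: fdf.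
- apply: derivable_within_continuous => x; rewrite in_itv /= => /andP[x0 _].
  by have [] := fdf _ x0.
rewrite in_itv /= subr0 => /andP[c0 _] /eqP; rewrite subr_eq => /eqP ->.
by rewrite addr_ge0 // mulr_ge0 // df0.
Qed.

(* Taylor's formula for [exp (- t)] is alternating, so the remainder has the
   sign of the first omitted term and is bounded by it. *)
Lemma exp_tail_bounds k t :
  0 <= t -> 0 <= (-1) ^+ k * exp_tail k t <= t ^+ k / k`!%:R.
Proof.
elim: k t => [|k IH] t t0.
  rewrite expr0 mul1r fact0 divr1 /exp_tail horner_poly big_ord0 subr0.
  by rewrite expR_ge0 /= expR_le1 oppr_le0.
(* The signed remainder [h] and the gap [b] to its upper bound both vanish at 0, and the induction
   hypothesis says that their derivatives are nonnegative. *)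
pose h s : R := (-1) ^+ k.+1 * exp_tail k.+1 s.
have dh (s : R) : is_derive s 1 h ((-1) ^+ k * exp_tail k s).
  apply: (@is_derive_fun _ _ _ _ _ _ _
    (is_deriveZ ((-1) ^+ k.+1) (is_derive_exp_tail k.+1 s))).
    by [].
  by rewrite /= exprS /GRing.scale /=; ring.
have h0 : h 0 = 0 by rewrite /h exp_tail0 mulr0.
apply/andP; split.
  apply: (@ge0_of_deriv h _ t (fun x _ => dh x)) t0; last by rewrite h0.
  by move=> x /IH /andP[].
rewrite -subr_ge0.
pose b s : R := s ^+ k.+1 / k.+1`!%:R - h s.
have db (s : R) : is_derive s 1 b (s ^+ k / k`!%:R - (-1) ^+ k * exp_tail k s).
  have dX : is_derive s 1 (fun s : R => k.+1`!%:R^-1 * s ^+ k.+1) (s ^+ k / k`!%:R).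
    apply: (@is_derive_fun _ _ _ _ _ _ _
      (is_derive_poly (k.+1`!%:R^-1 *: 'X^(k.+1)) s)).
      by move=> y; rewrite hornerZ hornerXn.
    rewrite derivZ derivXn hornerZ hornerMn hornerXn factS natrM -mulr_natr; field.
    by rewrite nat1r !pnatr_eq0 -lt0n fact_gt0.
  apply: (@is_derive_fun _ _ _ _ _ _ _ (is_deriveB dX (dh s))) => // y.
  by rewrite /b mulrC.
apply: (@ge0_of_deriv b _ t (fun x _ => db x)) t0.
- by move=> x /IH /andP[_]; rewrite subr_ge0.
- by rewrite /b h0 expr0n mul0r subrr.
Qed.

Lemma norm_exp_tail k t : 0 <= t -> `|exp_tail k t| = (-1) ^+ k * exp_tail k t.
Proof.
move=> t0; have /andP[h _] := exp_tail_bounds k t0.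
by rewrite -(ger0_norm h) normrM normrX normrN1 expr1n mul1r.
Qed.

Lemma exp_tail_le k t : 0 <= t -> `|exp_tail k t| <= t ^+ k.
Proof.
move=> t0; rewrite norm_exp_tail //; have /andP[_] := exp_tail_bounds k t0.
move/le_trans; apply; rewrite ler_pdivrMr ?ltr0n ?fact_gt0 //.
by rewrite ler_peMr ?exprn_ge0 // ler1n fact_gt0.
Qed.

(** The absolute remainder of order k + 1 equals t^k / k! minus that of order k. This bound, one
    power lower than [exp_tail_le], gives decay at infinity. *)
Lemma exp_tailS_le k t : 0 <= t -> `|exp_tail k.+1 t| <= t ^+ k.
Proof.
move=> t0; rewrite norm_exp_tail // exp_tailS mulrBr.
have -> : (-1) ^+ k.+1 * ((-1) ^+ k / k`!%:R * t ^+ k) = - (t ^+ k / k`!%:R).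
  by rewrite exprS [_ * t ^+ k]mulrAC !mulrA mulN1r mulNr -expr2 sqrr_sign; ring.
rewrite opprK exprS mulN1r mulNr addrC lerBlDr.
have /andP[h _] := exp_tail_bounds k t0.
rewrite (@le_trans _ _ (t ^+ k)) ?lerDl //.
rewrite ler_pdivrMr ?ltr0n ?fact_gt0 //.
by rewrite ler_peMr ?exprn_ge0 // ler1n fact_gt0.
Qed.

End ExpTail.

(** * Regularised even moments *)

Section ImproperFTC.
Context {R : realType}.
Local Notation mu := (@lebesgue_measure R).

(** The integrand may change sign, so the fundamental theorem on compact intervals exhausting the
    half-line is combined with dominated convergence, with |f| as the dominating function. *)
Lemma integrable_0y_FTC2 (f F : R -> R) (c l : R) :
  mu.-integrable `]0, +oo[ (EFin \o f) ->
  (forall x : R, 0 < x -> {for x, continuous f}) ->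
  (forall x : R, 0 < x -> is_derive x 1 F (f x)) ->
  F x @[x --> 0^'+] --> c -> F x @[x --> +oo] --> l ->
  Rintegral mu `]0, +oo[ f = l - c.
Proof.
move=> intf cf dF Fc Fl.
(* With n + 2 as right end the interval is nondegenerate already at n = 0. *)
pose a n : R := n.+1%:R^-1; pose b n : R := n.+2%:R.
have a0 n : 0 < a n by rewrite invr_gt0.
have ab n : a n < b n.
  by rewrite (@le_lt_trans _ _ 1) ?invf_le1 ?ltr1n // ?ler1n.
have mf := measurable_int _ intf.
pose D n : set R := `[a n, b n]%classic.
pose fn n x := (f x * \1_(D n) x)%:E.
have intD n : (\int[mu]_(x in `]0%R, +oo[) fn n x = (F (b n) - F (a n))%:E)%E.
  transitivity (\int[mu]_(x in `]0%R, +oo[) ((EFin \o f) \_ (D n)) x)%E.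
    apply: eq_integral => x _; rewrite /fn patchE indicE.
    by case: (x \in D n); rewrite ?mulr1 ?mulr0.
  rewrite -integral_mkcondr setIidr; last first.
    move=> x /=; rewrite !in_itv /= andbT => /andP[+ _].
      exact: lt_le_trans (a0 n).
  apply: continuous_FTC2 => //.
  - apply: continuous_in_subspaceT => x; rewrite inE /= in_itv /= => /andP[+ _].
    by move=> /(lt_le_trans (a0 n)) /cf.
  - have dc (x : R) : 0 < x -> {for x, continuous F}.
      by move=> /dF [dx _]; apply/differentiable_continuous/derivable1_diffP.
    split.
    + move=> x; rewrite in_itv /= => /andP[+ _] => /(lt_trans (a0 n)) /dF.
      by move=> d; exact: ex_derive.
    + by apply: cvg_at_right_filter; apply: dc.
    + by apply: cvg_at_left_filter; apply: dc; apply: lt_trans (ab n).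
  - move=> x; rewrite in_itv /= => /andP[+ _] => /(lt_trans (a0 n)) /dF d.
    by rewrite derive1E derive_val.
have [||||||_ _ cvgi] := @dominated_convergence _ _ _ mu `]0%R, +oo[ _ fn (EFin \o f)
  (fun x => `|f x|%:E).
- by [].
- move=> n; apply/measurable_EFinP/measurable_funM; first exact/measurable_EFinP.
  by apply: measurable_indic; exact: measurable_itv.
- exact: mf.
- apply: aeW => x /=; rewrite in_itv /= andbT => x0.
  (* A fixed x lies in [D n] as soon as n exceeds x and 1 / x. *)
  apply: cvg_near_cst.
  near=> n; suff Dx : D n x by rewrite /fn indicE mem_set //= mulr1.
  have xn : x <= n%:R by near: n; exact: nbhs_infty_ger.
  have x'n : x^-1 <= n%:R by near: n; exact: nbhs_infty_ger.
  rewrite /D /= in_itv /= /a invf_ple ?posrE // (le_trans x'n) ?ler_nat //.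
  by rewrite (le_trans xn) ?ler_nat // leqW.
- exact: integrable_abse intf.
- apply: aeW => x n _; rewrite /fn indicE lee_fin normrM.
  by case: (x \in D n); rewrite ?normr1 ?mulr1 // normr0 mulr0.
have cvg2 : (F (b n) - F (a n)) @[n --> \oo] --> l - c.
  apply: cvgB.
    move/cvg_pinftyP : Fl; apply; apply/cvgryPge => M; near=> n.
    apply: (@le_trans _ _ n%:R); last by rewrite ler_nat leqW.
    by near: n; exact: nbhs_infty_ger.
  move/cvg_at_rightP : Fc; apply; split=> //.
  exact: cvg_harmonic.
have cvg3 : (\int[mu]_(x in `]0%R, +oo[) fn n x)%E @[n --> \oo] --> (l - c)%:E.
  under eq_fun do rewrite intD.
  by apply: cvg_EFin; [exact: nearW | exact: cvg2].
rewrite /Rintegral; have -> : (\int[mu]_(x in `]0%R, +oo[) (f x)%:E = (l - c)%:E)%E.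
  by apply: cvg_unique cvgi cvg3.
by [].
Unshelve. all: by end_near. Qed.

End ImproperFTC.

(** * Decay, integrability and recurrence of the regularised weights *)

Section RegularizedWeights.
Context {R : realType}.
Local Notation mu := (@lebesgue_measure R).
Variable m : nat.

(* For [n >= m] the subtraction truncates and no Taylor term is removed. *)
Definition reg_weight n (x : R) : R :=
  x ^+ (2 * n) * x ^- (2 * m) * exp_tail (m - n) (x ^+ 2).

(** Independent exponents cover both w_n and x w_n, the primitive behind the recurrence. *)
Lemma is_derive_pow_tail a b k (x : R) : 0 < x ->
  is_derive x 1 (fun y : R => y ^+ a * y ^- b * exp_tail k (y ^+ 2))
    ((a%:R - b%:R) / x * (x ^+ a * x ^- b * exp_tail k (x ^+ 2))
     - 2 * x * (x ^+ a * x ^- b * exp_tail k.-1 (x ^+ 2))).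
Proof.
move=> x0; have xn0 : x != 0 by rewrite gt_eqF.
(* Written with a division by x, the derivative avoids the truncated exponent [c.-1]. *)
have pX c : is_derive x 1 (fun y : R => y ^+ c) (c%:R / x * x ^+ c).
  apply: (is_derive_fun _ _ (is_derive_poly ('X^c) x)) => [y|].
    by rewrite hornerXn.
  rewrite derivXn hornerMn hornerXn; case: c => [|c] /=; first by rewrite !mul0r.
  by rewrite exprS -mulr_natr; field.
have nz c : x ^+ c != 0 by rewrite expf_neq0.
have dV := @is_deriveV R (fun y => y ^+ b) x _ 1 (nz b) (pX b).
have dE := @is_derive1_comp R (exp_tail k) (fun y => y ^+ 2) x _ _
  (is_derive_exp_tail k (x ^+ 2)) (pX 2%N).
apply: (is_derive_fun _ _ (is_deriveM (is_deriveM (pX a) dV) dE)) => //.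
rewrite /GRing.scale /= -[X in X * (- exp_tail _ _ * _)]/(x ^+ a * x ^- b).
have := nz b; move: (x ^+ b) => B B0.
by field; rewrite xn0 B0.
Qed.

Lemma powM_expRN_le j (t : R) : 0 <= t -> t ^+ j * expR (- t) <= j`!%:R.
Proof.
move=> t0; rewrite expRN ler_pdivrMr ?expR_gt0 //.
case: j => [|j]; first by rewrite expr0 fact0 mul1r -expR0 ler_expR.
rewrite -ler_pdivrMl ?ltr0n ?fact_gt0 // mulrC.
by apply: le_trans (expR_ge1Dxn j t0); rewrite lerDr.
Qed.

Lemma reg_weight_lt n k (x : R) : 0 < x -> (m = n + k)%N ->
  reg_weight n x = x ^- (2 * k) * exp_tail k (x ^+ 2).
Proof.
move=> x0 e; rewrite /reg_weight e addKn mulnDr exprD invfM mulrA mulfV ?mul1r //.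
by rewrite expf_neq0 // gt_eqF.
Qed.

Lemma reg_weight_ge n k (x : R) : 0 < x -> (n = m + k)%N ->
  reg_weight n x = x ^+ (2 * k) * expR (- x ^+ 2).
Proof.
move=> x0 ->; rewrite /reg_weight subnDA subnn sub0n mulnDr exprD.
rewrite [_ * _ * x ^- _]mulrAC mulfV ?mul1r; last by rewrite expf_neq0 // gt_eqF.
by rewrite /exp_tail horner_poly big_ord0 subr0.
Qed.

(** The two bounds add up to (1 + x^2) |w_n| <= 2C. Below m they come from [exp_tail_le] and
    [exp_tailS_le]; from m on the Gaussian absorbs every power. *)
Lemma reg_weight_bound n : exists2 C : R, 0 <= C & forall x, 0 < x ->
  `|reg_weight n x| <= C /\ x ^+ 2 * `|reg_weight n x| <= C.
Proof.
have [lt_nm|le_mn] := ltnP n m.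
  exists 1 => // x x0; have [k e] : exists k, m = (n + k.+1)%N.
    by exists (m - n.+1)%N; lia.
  rewrite (reg_weight_lt x0 e) normrM ger0_norm ?invr_ge0 ?exprn_ge0 ?(ltW x0) //.
  have x2 : 0 <= x ^+ 2 by rewrite exprn_ge0 // ltW.
  have xk c : 0 < x ^+ c by rewrite exprn_gt0.
  split.
    rewrite ler_pdivrMl // mulr1 exprM; exact: exp_tail_le.
  rewrite mulrCA ler_pdivrMl // mulr1 mulnS exprD ler_pM2l // exprM.
  exact: exp_tailS_le.
have [k e] : exists k, n = (m + k)%N by exists (n - m)%N; lia.
exists (k`!%:R + k.+1`!%:R); first by rewrite addr_ge0.
move=> x x0; have x2 : 0 <= x ^+ 2 by rewrite exprn_ge0 // ltW.
rewrite (reg_weight_ge x0 e) ger0_norm ?mulr_ge0 ?expR_ge0 ?exprn_ge0 ?(ltW x0) //.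
rewrite exprM mulrA -exprS; split.
  by rewrite (le_trans (powM_expRN_le _ _)) // lerDl.
by rewrite (le_trans (powM_expRN_le _ _)) // lerDr.
Qed.

Lemma continuous_reg_weight n (x : R) : 0 < x -> {for x, continuous (reg_weight n)}.
Proof.
move=> x0; have [d _] := is_derive_pow_tail (2 * n) (2 * m) (m - n) x0.
exact/differentiable_continuous/derivable1_diffP.
Qed.

Lemma integrable_reg_weight n :
  mu.-integrable `]0, +oo[ (EFin \o reg_weight n).
Proof.
have [C C0 bC] := reg_weight_bound n.
have mcont (f : R -> R) : (forall x : R, 0 < x -> {for x, continuous f}) ->
    measurable_fun (`]0%R, +oo[%classic : set (measurableTypeR R)) f.
  move=> cf; apply: open_continuous_measurable_fun; first exact: interval_open.
  by move=> x; rewrite inE /= in_itv /= andbT; exact: cf.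
have iD : mu.-integrable `]0, +oo[ (EFin \o (fun x : R => (oneDsqr x)^-1)).
  have mD : measurable_fun (`]0%R, +oo[%classic : set (measurableTypeR R))
      (fun x : R => (oneDsqr x)^-1).
    by apply: mcont => x _; exact: continuous_oneDsqrV.
  apply/integrableP; split; first exact/measurable_EFinP.
  under eq_integral do rewrite /= ger0_norm ?invr_ge0 ?(le_trans ler01) ?oneDsqr_ge1 //.
  rewrite integral_itv_obnd_cbnd; last exact/measurable_EFinP.
  by rewrite integral0y_oneDsqr ltry.
apply: (@le_integrable _ _ _ mu _ (measurable_itv _) _
  (fun x => ((2 * C)%:E * ((oneDsqr x)^-1)%:E)%E)).
- apply/measurable_EFinP; apply: mcont => x x0; exact: continuous_reg_weight.
- move=> x /=; rewrite in_itv /= andbT => x0.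
  have [b1 b2] := bC _ x0.
  have o1 := oneDsqr_ge1 x; have o0 : 0 < oneDsqr x by exact: lt_le_trans o1.
  rewrite lee_fin [leRHS]ger0_norm ?mulr_ge0 // ?invr_ge0 ?(ltW o0) //.
  rewrite ler_pdivlMr // /oneDsqr mulrDr mulr1 mulr_natl mulr2n lerD // mulrC //.
- by apply: integrableZl; first exact: measurable_itv.
Qed.

Lemma reg_weight_rec n :
  2 * Rintegral mu `]0, +oo[ (reg_weight n.+1) =
  ((2 * n).+1%:R - (2 * m)%:R) * Rintegral mu `]0, +oo[ (reg_weight n).
Proof.
pose c : R := (2 * n).+1%:R - (2 * m)%:R.
pose f x : R := c * reg_weight n x - 2 * reg_weight n.+1 x.
pose F x : R := x * reg_weight n x.
have i1 := integrable_reg_weight n; have i2 := integrable_reg_weight n.+1.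
have j1 : mu.-integrable `]0, +oo[ (fun x => c%:E * (reg_weight n x)%:E)%E.
  by apply: integrableZl; first exact: measurable_itv.
have j2 : mu.-integrable `]0, +oo[ (fun x => 2%:E * (reg_weight n.+1 x)%:E)%E.
  by apply: integrableZl; first exact: measurable_itv.
suff : Rintegral mu `]0, +oo[ f = 0 - 0.
  rewrite subr0 /f RintegralB //; try exact: measurable_itv.
  rewrite !RintegralZl //; try exact: measurable_itv.
  by move/eqP; rewrite subr_eq0 => /eqP ->.
have [C C0 bC] := reg_weight_bound n.
apply: (@integrable_0y_FTC2 _ f F).
- by apply: (integrableB _ j1 j2); exact: measurable_itv.
- move=> x x0; apply: cvgB; apply: cvgZl_tmp; exact: continuous_reg_weight.
- move=> x x0; have xn0 : x != 0 by rewrite gt_eqF.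
  apply: (is_derive_fun _ _ (is_derive_pow_tail (2 * n).+1 (2 * m) (m - n) x0)).
    by move=> y; rewrite /F /reg_weight exprS !mulrA.
  (* The order m - (n + 1) is the predecessor of m - n even under truncation, so the second term of
     the derivative is -2 w_(n+1). *)
  rewrite /f /reg_weight -/c subnS mulnS exprD exprS.
  by field; rewrite ?xn0 ?expf_neq0.
(* Near 0, w_n is bounded, so x w_n tends to 0; [C + 1] is used as divisor because [C] may be 0. *)
- apply/cvgr0Pnorm_le => e e0.
  near=> x; have x0 : 0 < x by near: x; exact: nbhs_right_gt.
  rewrite normrM gtr0_norm // (@le_trans _ _ (x * (C + 1))) //.
    by rewrite ler_pM2l // (le_trans (bC _ x0).1) // lerDl.
  rewrite -ler_pdivlMr ?ltr_wpDl //; near: x.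
  by apply: nbhs_right_le; rewrite divr_gt0 // ltr_wpDl.
(* At infinity the second bound gives |x w_n| <= C / x. *)
- apply/cvgr0Pnorm_le => e e0.
  near=> x; have x0 : 0 < x by near: x; exact: nbhs_pinfty_gt.
  rewrite normrM gtr0_norm // -(ler_pM2l x0) mulrA -expr2.
  have Cx : C / e <= x by near: x; apply: nbhs_pinfty_ge; exact: num_real.
  by rewrite (le_trans (bC _ x0).2) // -ler_pdivrMr.
Unshelve. all: by end_near. Qed.

(** By the recurrence a vanishing integral makes the next one vanish, so a zero at 0 would reach
    index m, where the integral is sqrt(pi) / 2. *)
Lemma reg_weight_integral_neq0 : Rintegral mu `]0, +oo[ (reg_weight 0) != 0.
Proof.
have im : Rintegral mu `]0, +oo[ (reg_weight m) != 0.
  have -> : Rintegral mu `]0, +oo[ (reg_weight m) = Rintegral mu `]0, +oo[ gauss_fun.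
    apply: eq_Rintegral => x; rewrite inE /= in_itv /= andbT => x0.
    by rewrite [LHS](reg_weight_ge x0 (esym (addn0 m))) muln0 expr0 mul1r.
  rewrite /Rintegral integral_itv_obnd_cbnd.
    by rewrite integral0y_gauss /= mulf_neq0 ?invr_eq0 // gt_eqF // sqrtr_gt0 pi_gt0.
  by apply/measurable_EFinP/measurable_funTS; exact: measurable_gauss_fun.
have step k : Rintegral mu `]0, +oo[ (reg_weight k) = 0 ->
    Rintegral mu `]0, +oo[ (reg_weight k.+1) = 0.
  move=> k0; have := reg_weight_rec k; rewrite k0 mulr0 => /eqP.
  by rewrite mulf_eq0 pnatr_eq0 => /eqP.
apply: contra im => /eqP I0.
suff : forall k, Rintegral mu `]0, +oo[ (reg_weight k) = 0 by move=> ->.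
by elim=> // k /step.
Qed.

End RegularizedWeights.

(** * The regularised functional *)

Section GaussTaylor.
Context {R : realType}.
Implicit Types (p a b : {poly R}) (x : R).

(** The derivative conjugated by exp(-x^2). *)
Definition gauss_deriv p : {poly R} := p^`() - 2 *: 'X * p.

Lemma derive1n_gauss k p :
  derive1n k (fun x : R => p.[x] * expR (- x ^+ 2)) =
  (fun x => (iter k gauss_deriv p).[x] * expR (- x ^+ 2)).
Proof.
elim: k => [//|k IH]; rewrite derive1nS IH iterS; move: (iter _ _ _) => {IH}p.
apply/funext => x; rewrite derive1E.
have dX : is_derive x 1 (fun y : R => - y ^+ 2) (- (2 * x)).
  apply: (is_derive_fun _ _ (is_derive_poly (- 'X^2) x)) => [y|].
    by rewrite hornerN hornerXn.
  by rewrite derivN derivXn hornerN hornerMn hornerX mulr_natl.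
have dE := @is_derive1_comp R (@expR R) (fun y => - y ^+ 2) x _ _ (is_derive_expR _) dX.
have [_ ->] := is_deriveM (is_derive_poly p x) dE.
by rewrite /GRing.scale /= /gauss_deriv hornerD hornerN hornerM hornerZ hornerX; ring.
Qed.

(** The truncated Gaussian satisfies q' + 2xq = 0 up to a term of degree 2n + 1, too high to affect
    the Taylor coefficients needed. *)
Lemma deriv_exp_poly_sqr n :
  (exp_poly n.+1 \Po 'X^2)^`() + 2 *: 'X * (exp_poly n.+1 \Po 'X^2) =
  (2 * (-1) ^+ n / n`!%:R) *: 'X^((2 * n).+1) :> {poly R}.
Proof.
have e : exp_poly n.+1 = exp_poly n + ((-1) ^+ n / n`!%:R) *: 'X^n :> {poly R}.
  apply/polyP => i; rewrite coefD coefZ coefXn !coef_poly ltnS leq_eqVlt.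
  by case: ltngtP => [||->]; rewrite ?mulr0 ?mulr1 ?addr0 ?add0r.
rewrite deriv_comp deriv_exp_poly derivXn e raddfN comp_polyD comp_polyZ /=
  comp_Xn_poly.
by rewrite -exprM [in RHS]exprS -!mul_polyC -mulrA polyCM; ring.
Qed.

(* Up to order 2n, [q := exp_poly n.+1 \Po 'X^2] behaves as [exp (- x^2)]: by
   [deriv_exp_poly_sqr], multiplying by [q] turns [gauss_deriv] into the
   derivative. *)
Lemma gauss_taylor n p k : (k <= 2 * n)%N ->
  (iter k gauss_deriv p).[0] = k`!%:R * (p * (exp_poly n.+1 \Po 'X^2))`_k.
Proof.
elim: k p => [|k IH] p le_k.
  rewrite fact0 mul1r coef0M /= horner_coef0; set q := _ \Po _.
  suff -> : q`_0 = 1 by rewrite mulr1.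
  rewrite -horner_coef0 horner_comp hornerXn expr0n horner_coef0 coef_poly /=.
  by rewrite fact0 expr0 divr1.
rewrite iterSr IH; last by rewrite ltnW.
have := deriv_exp_poly_sqr n; set q := _ \Po _ => dq.
have -> : gauss_deriv p * q = (p * q)^`() - p * (q^`() + 2 *: 'X * q).
  by rewrite /gauss_deriv derivM -!mul_polyC; ring.
rewrite dq coefB coef_deriv -scalerAr coefZ coefMXn ltnS (ltnW le_k) mulr0 subr0.
by rewrite factS natrM -[_ *+ k.+1]mulr_natr; ring.
Qed.

(** The real counterpart of [hermite_integrand], to which real and imaginary parts both reduce. *)
Definition hermite_real m a x : R :=
  ((a.[x] + a.[- x]) * expR (- x ^+ 2)
   - \sum_(0 <= k < (2 * m - 2).+1)
       derive1n k (fun t => (a.[t] + a.[- t]) * expR (- t ^+ 2)) 0 *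
       (x ^+ k / k`!%:R)) * x ^- (2 * m).

Definition hermite_real_num m p x : R :=
  p.[x] * expR (- x ^+ 2)
  - (take_poly (2 * m - 1) (p * (exp_poly m \Po 'X^2))).[x].

(** [gauss_taylor] at m - 1 reaches order 2m - 2, exactly the last order subtracted; the iterated
    derivatives become a polynomial truncation, visibly linear in [a]. *)
Lemma hermite_realE m a x : (1 <= m)%N ->
  hermite_real m a x = hermite_real_num m (a + (a \Po - 'X)) x * x ^- (2 * m).
Proof.
case: m => // m _; congr (_ * _); set p := a + _.
have pE : (fun t => (a.[t] + a.[- t]) * expR (- t ^+ 2)) =
          (fun t => p.[t] * expR (- t ^+ 2)).
  by apply/funext => t; rewrite hornerD horner_comp hornerN hornerX.
rewrite pE -[X in X - _]/((fun t => (a.[t] + a.[- t]) * expR (- t ^+ 2)) x) pE.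
congr (_ - _); rewrite /take_poly horner_poly big_mkord.
have -> : (2 * m.+1 - 1 = (2 * m.+1 - 2).+1)%N by lia.
apply: eq_bigr => k _; rewrite derive1n_gauss /= (@gauss_taylor m); last first.
  by have := ltn_ord k; lia.
rewrite expr0n /= oppr0 expR0 mulr1; field.
by rewrite pnatr_eq0 -lt0n fact_gt0.
Qed.

Lemma hermite_real_linear m c a b x : (1 <= m)%N ->
  hermite_real m (c *: a + b) x = c * hermite_real m a x + hermite_real m b x.
Proof.
move=> m1; rewrite !hermite_realE // mulrA -mulrDl; congr (_ * _).
rewrite /hermite_real_num comp_polyD comp_polyZ addrACA -scalerDr.
move: (a + _) (b + _) => p q.
by rewrite [_ * (_ \Po _)]mulrDl -scalerAl take_polyD take_polyZ !hornerD !hornerZ; ring.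
Qed.

Lemma hermite_real_odd m n x : (1 <= m)%N -> odd n -> hermite_real m 'X^n x = 0.
Proof.
move=> m1 on; rewrite hermite_realE // comp_Xn_poly exprNn -signr_odd on.
by rewrite mulN1r subrr /hermite_real_num !mul0r take_poly0r horner0 mul0r subrr mul0r.
Qed.

Lemma hermite_real_even m n x : (1 <= m)%N ->
  hermite_real m 'X^(2 * n) x = 2 * reg_weight m n x.
Proof.
move=> m1; rewrite hermite_realE // comp_Xn_poly exprNn -signr_odd mul2n odd_double.
rewrite mul1r -mul2n -mulr2n -scaler_nat /hermite_real_num -scalerAl.
(* The terms x^(2n + 2j) of degree below 2m - 1 are those with n + j < m: there are m - n of them,
   and none once n >= m. *)
have -> : take_poly (2 * m - 1) (2 *: ('X^(2 * n) * (exp_poly m \Po 'X^2))) =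
    2 *: ('X^(2 * n) * (exp_poly (m - n) \Po 'X^2)) :> {poly R}.
  rewrite take_polyZ; congr (_ *: _); apply/polyP => i.
  rewrite coef_take_poly !coefXnM !coef_comp_poly_Xn // !coef_poly.
  case: (ltnP i (2 * n)%N) => hi; first by rewrite if_same.
  case: (boolP (2 %| i - 2 * n)%N) => hd; last by rewrite if_same.
  have -> : ((i - 2 * n) %/ 2 < m - n)%N =
     ((i < 2 * m - 1)%N && ((i - 2 * n) %/ 2 < m)%N).
    by apply/idP/andP => [h|[h1 h2]]; first split; lia.
  by case: (i < _)%N.
rewrite !hornerZ !hornerM hornerXn horner_comp hornerXn /reg_weight /exp_tail.
ring.
Qed.

End GaussTaylor.

(** * The functional on real polynomials *)

Section HermiteRealFunctional.
Context {R : realType}.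
Local Notation mu := (@lebesgue_measure R).
Variable m : nat.
Hypothesis m1 : (1 <= m)%N.

Lemma integrable_hermite_realXn n :
  mu.-integrable `]0, +oo[ (EFin \o @hermite_real R m 'X^n).
Proof.
case: (boolP (odd n)) => on.
  have -> : EFin \o @hermite_real R m 'X^n = cst 0%E.
    by apply/funext => x /=; rewrite hermite_real_odd.
  by apply: integrable0.
have en : n = (2 * n./2)%N by rewrite mul2n even_halfK.
have -> : EFin \o @hermite_real R m 'X^n =
    (fun x => 2%:E * (reg_weight m n./2 x)%:E)%E.
  by apply/funext => x /=; rewrite en hermite_real_even // -en.
by apply: integrableZl; [exact: measurable_itv | exact: integrable_reg_weight].
Qed.

Lemma integrable_hermite_real a :
  mu.-integrable `]0, +oo[ (EFin \o @hermite_real R m a).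
Proof.
pose J (p : {poly R}) := mu.-integrable `]0, +oo[ (EFin \o @hermite_real R m p).
have JD c p q : J p -> J q -> J (c *: p + q).
  move=> Jp Jq.
  have Jcp : mu.-integrable `]0, +oo[ (fun x => c%:E * (hermite_real m p x)%:E)%E.
    by apply: integrableZl; first exact: measurable_itv.
  rewrite /J (_ : _ \o _ = (fun x =>
     c%:E * (hermite_real m p x)%:E + (hermite_real m q x)%:E)%E).
    by apply: (integrableD _ Jcp Jq); exact: measurable_itv.
  by apply/funext => x /=; rewrite hermite_real_linear.
have J0 : J 0.
  (* Closure under combinations c p + q yields 0 from the monomial 1. *)
  have -> : 0 = (-1) *: 1 + 1 :> {poly R} by rewrite scaleN1r addNr.
  by apply: JD; exact: (integrable_hermite_realXn 0).
rewrite -/(J a) -[a]coefK poly_def; elim/big_ind: _ => // [p q Jp Jq|i _].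
  by rewrite -[p]scale1r; exact: JD.
by rewrite -[_ *: _]addr0; apply: JD => //; exact: integrable_hermite_realXn.
Qed.

Definition hermite_real_functional (a : {poly R}) : R :=
  Rintegral mu `]0, +oo[ (hermite_real m a).

Lemma hermite_real_functional_linear c a b :
  hermite_real_functional (c *: a + b) =
  c * hermite_real_functional a + hermite_real_functional b.
Proof.
have ia := integrable_hermite_real a; have ib := integrable_hermite_real b.
have ica : mu.-integrable `]0, +oo[ (fun x => c%:E * (hermite_real m a x)%:E)%E.
  by apply: integrableZl; first exact: measurable_itv.
rewrite /hermite_real_functional -RintegralZl //; try exact: measurable_itv.
rewrite -RintegralD //; try exact: measurable_itv.
by apply: eq_Rintegral => x _; exact: hermite_real_linear.
Qed.

Lemma hermite_real_functional_odd n :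
  odd n -> hermite_real_functional 'X^n = 0.
Proof.
move=> on; rewrite /hermite_real_functional /Rintegral integral0_eq // => x _.
by rewrite hermite_real_odd.
Qed.

Lemma hermite_real_functional_even n :
  hermite_real_functional 'X^(2 * n) = 2 * Rintegral mu `]0, +oo[ (reg_weight m n).
Proof.
have iw := integrable_reg_weight m n.
rewrite -RintegralZl //; try exact: measurable_itv.
by apply: eq_Rintegral => x _; exact: hermite_real_even.
Qed.

End HermiteRealFunctional.

(** * Real and imaginary parts of the integrand *)

Section Components.
Context {R : realType}.
Variable h : R[i] -> R.
Hypotheses (hD : forall y z, h (y + z) = h y + h z)
  (hZ : forall z r, h (z * r%:C) = h z * r).

Let h0 : h 0 = 0.
Proof. by rewrite -[0](mulr0 1) -[X in 1 * X]/(0%:C) hZ mulr0. Qed.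

Let hN z : h (- z) = - h z.
Proof. by apply/eqP; rewrite -addr_eq0 -hD addNr h0. Qed.

(** Powers of a real point are real, so [h], meant for [Re] and [Im], passes to the coefficients. *)
Lemma horner_component (f : {poly R[i]}) (x : R) : h f.[x%:C] = (map_poly h f).[x].
Proof.
rewrite horner_coef (big_morph _ hD h0) (horner_coef_wide _ (size_poly _ _)).
apply: eq_bigr => k _; rewrite coef_map_id0 // -hZ; congr (h (_ * _)).
by rewrite rmorphXn.
Qed.

Lemma sym_gauss_component f x :
  h (sym_gauss f x) =
  ((map_poly h f).[x] + (map_poly h f).[- x]) * expR (- x ^+ 2).
Proof. by rewrite /sym_gauss hZ hD !horner_component. Qed.

(** For [Re] and [Im] the hypothesis holds by computation, since [cderiven] acts componentwise. *)
Lemma hermite_integrand_component m f x :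
  (forall k, h (cderiven k (sym_gauss f) 0) =
             derive1n k (fun t => h (sym_gauss f t)) 0) ->
  h (hermite_integrand m f x) = hermite_real m (map_poly h f) x.
Proof.
move=> hd; rewrite /hermite_integrand hZ hD hN (big_morph _ hD h0).
rewrite /hermite_real sym_gauss_component; congr ((_ - _) * _).
have e : (fun t => h (sym_gauss f t)) = (fun t =>
    ((map_poly h f).[t] + (map_poly h f).[- t]) * expR (- t ^+ 2)).
  by apply/funext => t; exact: sym_gauss_component.
by apply: eq_bigr => k _; rewrite hZ hd e.
Qed.

End Components.

(** * Linearity and moments of the complex functional *)

Section HermiteFunctional.
Context {R : realType}.
Variable m : nat.
Hypothesis m1 : (1 <= m)%N.
Implicit Types f g : {poly R[i]}.
Local Notation Rep f := (map_poly (@complex.Re R) f).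
Local Notation Imp f := (map_poly (@complex.Im R) f).

Lemma ReD (y z : R[i]) : complex.Re (y + z) = complex.Re y + complex.Re z.
Proof. by case: y z => [? ?] []. Qed.
Lemma ImD (y z : R[i]) : complex.Im (y + z) = complex.Im y + complex.Im z.
Proof. by case: y z => [? ?] []. Qed.
Lemma ReZ (z : R[i]) r : complex.Re (z * r%:C) = complex.Re z * r.
Proof. by case: z => a b /=; rewrite mulr0 subr0. Qed.
Lemma ImZ (z : R[i]) r : complex.Im (z * r%:C) = complex.Im z * r.
Proof. by case: z => a b /=; rewrite mulr0 add0r. Qed.

Lemma Re_hermite_integrand f x :
  complex.Re (hermite_integrand m f x) = hermite_real m (Rep f) x.
Proof. by apply: hermite_integrand_component => //; [exact: ReD|exact: ReZ]. Qed.

Lemma Im_hermite_integrand f x :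
  complex.Im (hermite_integrand m f x) = hermite_real m (Imp f) x.
Proof. by apply: hermite_integrand_component => //; [exact: ImD|exact: ImZ]. Qed.

Lemma cintegrable_hermite f : cintegrable `]0, +oo[ (hermite_integrand m f).
Proof.
split.
  have -> : (fun x => (complex.Re (hermite_integrand m f x))%:E) =
      EFin \o hermite_real m (Rep f).
    by apply/funext => x /=; rewrite Re_hermite_integrand.
  exact: integrable_hermite_real.
have -> : (fun x => (complex.Im (hermite_integrand m f x))%:E) =
    EFin \o hermite_real m (Imp f).
  by apply/funext => x /=; rewrite Im_hermite_integrand.
exact: integrable_hermite_real.
Qed.

Lemma hermite_functionalE f : hermite_functional m f =
  hermite_real_functional m (Rep f) +i* hermite_real_functional m (Imp f).
Proof.
rewrite /hermite_functional /cintegral.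
by congr (_ +i* _); apply: eq_Rintegral => x _;
  [exact: Re_hermite_integrand|exact: Im_hermite_integrand].
Qed.

Lemma hermite_functional_scalar : scalar (@hermite_functional R m).
Proof.
move=> [a b] f g; rewrite !hermite_functionalE.
(* A complex scalar mixes the two parts; the nesting lets real linearity apply twice. *)
have -> : Rep ((a +i* b) *: f + g) = a *: Rep f + ((- b) *: Imp f + Rep g).
  apply/polyP => k; rewrite !(coefD, coefZ, coef_map_id0) //.
  by case: f`_k g`_k => [? ?] [? ?] /=; ring.
have -> : Imp ((a +i* b) *: f + g) = a *: Imp f + (b *: Rep f + Imp g).
  apply/polyP => k; rewrite !(coefD, coefZ, coef_map_id0) //.
  by case: f`_k g`_k => [? ?] [? ?] /=; ring.
rewrite !hermite_real_functional_linear //.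
by apply/eqP; rewrite eq_complex /=; apply/andP; split; apply/eqP; ring.
Qed.

Lemma hermite_functionalXn n :
  hermite_functional m 'X^n = (hermite_real_functional m ('X^n : {poly R}))%:C.
Proof.
rewrite hermite_functionalE; apply/eqP; rewrite eq_complex /=.
have -> : Rep 'X^n = 'X^n.
  by apply/polyP => k; rewrite coef_map_id0 // !coefXn; case: (_ == _).
(* Zero in this form lets linearity show that the imaginary part vanishes. *)
have -> : Imp 'X^n = (-1) *: 1 + 1.
  apply/polyP => k; rewrite coef_map_id0 // scaleN1r addNr coef0 !coefXn.
  by case: (_ == _).
rewrite hermite_real_functional_linear // mulN1r addNr.
by rewrite !eqxx.
Qed.

Lemma hermite_functional_moments (u : {scalar {poly R[i]}}) :
  u =1 @hermite_functional R m -> hermite_moments u m.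
Proof.
move=> uE; split=> [|n on|n].
- rewrite -(expr0 'X) uE hermite_functionalXn.
  rewrite -[0%N]/(2 * 0)%N hermite_real_functional_even // eq_complex /= negb_and.
  by rewrite mulf_neq0 ?pnatr_eq0 ?reg_weight_integral_neq0.
- by rewrite uE hermite_functionalXn hermite_real_functional_odd.
- rewrite !uE !hermite_functionalXn.
  have -> : 2 = (2 : R)%:C :> R[i] by rewrite rmorph_nat.
  rewrite -!(rmorph_nat (real_complex R)) -rmorphB -!rmorphM; congr (_%:C).
  case: (boolP (odd n)) => on.
    by rewrite !hermite_real_functional_odd ?mulr0 //= negbK.
  have -> : n = (2 * n./2)%N by rewrite mul2n even_halfK.
  have -> : ((2 * n./2).+2 = 2 * n./2.+1)%N by rewrite mulnS.
  rewrite !hermite_real_functional_even // mulrCA reg_weight_rec; ring.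
Qed.

End HermiteFunctional.

Unset Implicit Arguments.

Theorem theorem2p11 (R : realType) (m : nat) (hm : (1 <= m)%N) :
  [/\ (forall f : {poly R[i]}, cintegrable `]0, +oo[ (hermite_integrand m f))
        /\ scalar (@hermite_functional R m),
      semiclassical (@hermite_functional R m),
      has_class (@hermite_functional R m) 1 &
      pearson 'X (2%:R *: 'X^2 + (2 * m - 1)%:R%:P) (@hermite_functional R m)].
Proof.
have hlin : scalar (@hermite_functional R m) := hermite_functional_scalar hm.
pose u : {scalar {poly R[i]}} :=
  HB.pack (@hermite_functional R m) (GRing.isLinear.Build _ _ _ _ _ hlin).
have um : hermite_moments u m by exact: hermite_functional_moments.
have hc : has_class u 1 := hermite_has_class1 um hm.
split; last exact: (hermite_pearson um hm).
- by split=> // f; exact: cintegrable_hermite.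
- split; first exact: (hermite_quasi_definite um).
  by have [[phi [psi [adm _]]] _] := hc; exists phi, psi.
- exact: hc.
Qed.
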